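(* Let $E$ and $F$ be Banach lattices and let $\mathcal{T}$ be a norm bounded, collectively M-weakly compact family of operators from $E$ to $F$. Then for each $\varepsilon>0$ there exists $u\in E_+$ such that $$\sup_{T\in\mathcal{T}}\bigl\|T\bigl[(|x|-u)^+\bigr]\bigr\|\le\varepsilon$$ holds for all $x\in B_E$.
   Context: All vector spaces are real and operators are linear. $B_E$ is the closed unit ball of $E$ and $E_+$ its positive cone. A norm bounded family $\mathcal{T}$ of bounded operators from $E$ to $F$ is collectively M-weakly compact if $\sup_{T\in\mathcal{T}}\|Tx_n\|\to 0$ for every disjoint sequence $(x_n)$ in $B_E$. *)

(* Defs.v *)
From HB Require Import structures.
From mathcomp Require Import all_boot all_order all_algebra.
From mathcomp Require Import all_classical all_reals all_analysis.

Set Implicit Arguments.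
Unset Strict Implicit.
Unset Printing Implicit Defensive.

Import Order.TTheory GRing.Theory Num.Theory.
Import numFieldNormedType.Exports.

Local Open Scope classical_set_scope.
Local Open Scope ring_scope.

(* A Riesz space cannot be declared as a join of [Order.Lattice] with
   [GRing.Lmodule] or with the normed modules: Hierarchy Builder rejects it
   because [Num.RealDomain] and [Num.NumDomain] already inherit from these
   without the join. The order is therefore part of the mixin, and the library
   order structures are declared afterwards on the sorts. *)
HB.mixin Record Lmodule_isRiesz (R : realType) E & GRing.Lmodule R E := {
  rle : rel E ;
  rmeet : E -> E -> E ;
  rjoin : E -> E -> E ;
  rle_refl : reflexive rle ;
  rle_anti : antisymmetric rle ;
  rle_trans : transitive rle ;
  rmeetP : forall x y z : E, rle x (rmeet y z) = rle x y && rle x z ;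
  rjoinP : forall x y z : E, rle (rjoin x y) z = rle x z && rle y z ;
  rleD2r : forall z x y : E, rle x y -> rle (x + z) (y + z) ;
  rle_scale : forall (a : R) (x : E), 0 <= a -> rle 0 x -> rle 0 (a *: x)
}.

#[short(type="rieszSpaceType")]
HB.structure Definition RieszSpace (R : realType) :=
  {E of GRing.Lmodule R E & Lmodule_isRiesz R E}.

HB.instance Definition _ (R : realType) (E : rieszSpaceType R) :=
  Order.Le_isPOrder.Build ring_display E rle_refl rle_anti rle_trans.
HB.instance Definition _ (R : realType) (E : rieszSpaceType R) :=
  Order.POrder_MeetJoin_isLattice.Build ring_display E rmeetP rjoinP.

(* `|x| is the norm in the library, hence the prefix names here. *)
Section RieszSpaceTheory.
Context {R : realType} {E : rieszSpaceType R}.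

Definition modulus (x : E) : E := (x `|` - x)%O.

Definition pos_part (x : E) : E := (x `|` 0)%O.

Definition pos_cone : set E := [set x | 0 <= x].

Definition disjoint_seq (x : nat -> E) : Prop :=
  forall m n, m != n -> (modulus (x m) `&` modulus (x n))%O = 0.

End RieszSpaceTheory.

HB.mixin Record NormedModule_Riesz_isLatticeNorm (R : realType) E
    & NormedModule R E & RieszSpace R E := {
  lattice_norm : forall x y : E, modulus x <= modulus y -> `|x| <= `|y|
}.

#[short(type="banachLatticeType")]
HB.structure Definition BanachLattice (R : realType) :=
  {E of CompleteNormedModule R E & RieszSpace R E
      & NormedModule_Riesz_isLatticeNorm R E}.

HB.instance Definition _ (R : realType) (E : banachLatticeType R) :=
  Order.Lattice.copy E (E : rieszSpaceType R).

Section Operators.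
Context {R : realType}.

Definition unit_ball {E : normedModType R} : set E := [set x | `|x| <= 1].

(* [sup] returns 0 on sets without an upper bound: [opnorm] is meaningful only
   for bounded operators. *)
Definition opnorm (E F : normedModType R) (T : {linear E -> F}) : R :=
  sup [set `|T x| | x in unit_ball].

Definition norm_bounded (E F : normedModType R) (TT : set {linear E -> F}) :=
  (forall T, TT T -> bounded_fun_norm T) /\
  has_ubound [set opnorm T | T in TT].

(* Norm boundedness is part of the definition; it makes the suprema below
   those of bounded sets. *)
Definition collectively_Mweakly_compact (E F : banachLatticeType R)
    (TT : set {linear E -> F}) :=
  norm_bounded TT /\
  forall x : nat -> E, (forall n, unit_ball (x n)) -> disjoint_seq x ->
    sup [set `|T (x n)| | T in TT] @[n --> \oo] --> (0 : R).

End Operators.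

(* Main.v *)
Require Import Defs.
From HB Require Import structures.
From mathcomp Require Import all_boot all_order all_algebra.
From mathcomp Require Import all_classical all_reals all_analysis.
Import Order.TTheory GRing.Theory Num.Theory.
Import numFieldNormedType.Exports.
Local Open Scope classical_set_scope.
Local Open Scope ring_scope.

(* If no u works for eps, then, starting from S_0 = 0, one picks x_n in the unit
   ball and T_n in TT such that w_n = (|x_n| - 4^n S_n)^+ satisfies
   ||T_n w_n|| > eps, where S_n = sum_(i < n) |x_i|. With
   y = sum_n 2^-n |x_n|, the elements v_n = (|x_n| - 4^n S_n - 2^-n y)^+ of the
   unit ball are pairwise disjoint: for n < m and c = 2^(m + n) <= 4^m,
   v_m <= (|x_m| - c |x_n|)^+ and v_n <= (|x_n| - c^-1 |x_m|)^+.
   Hence sup_T ||T v_n|| tends to 0, and since 0 <= w_n - v_n <= 2^-n y so does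
   ||T_n w_n||, a contradiction. *)

(** * Ordered vector spaces, positive parts and disjointness *)

Section RieszSpace.
Context {R : realType} {E : rieszSpaceType R}.
Implicit Types (x y z : E) (c : R).

Lemma riesz_leD2r z x y : (x + z <= y + z) = (x <= y).
Proof.
apply/idP/idP => [/(rleD2r (- z))|]; last exact: rleD2r.
by rewrite !addrK.
Qed.

Lemma riesz_subr_ge0 x y : (0 <= y - x) = (x <= y).
Proof. by rewrite -(riesz_leD2r x 0) add0r subrK. Qed.

Lemma riesz_leBlDr x y z : (x - y <= z) = (x <= z + y).
Proof. by rewrite -(riesz_leD2r y (x - y)) subrK. Qed.

Lemma riesz_leBrDr x y z : (x <= y - z) = (x + z <= y).
Proof. by rewrite -(riesz_leD2r z x) subrK. Qed.

Lemma riesz_leD {x y z w : E} : x <= y -> z <= w -> x + z <= y + w.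
Proof.
move=> xy zw; apply: (@le_trans _ _ (y + z)); first by rewrite riesz_leD2r.
by rewrite ![y + _]addrC riesz_leD2r.
Qed.

Lemma riesz_leN2 x y : (- x <= - y) = (y <= x).
Proof. by rewrite -[LHS]riesz_subr_ge0 opprK addrC riesz_subr_ge0. Qed.

Lemma riesz_leB {x y z w : E} : x <= y -> w <= z -> x - z <= y - w.
Proof. by move=> xy zw; apply: riesz_leD => //; rewrite riesz_leN2. Qed.

Lemma riesz_ler_wpZ2l c x y : 0 <= c -> x <= y -> c *: x <= c *: y.
Proof.
move=> c0 xy; rewrite -riesz_subr_ge0 -scalerBr; apply: rle_scale => //.
by move: xy; rewrite -riesz_subr_ge0.
Qed.

Lemma riesz_scale_ge0 c x : 0 <= c -> 0 <= x -> 0 <= c *: x.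
Proof. exact: rle_scale. Qed.

Lemma riesz_ler_wpZ2r c d x : c <= d -> 0 <= x -> c *: x <= d *: x.
Proof.
by move=> cd x0; rewrite -riesz_subr_ge0 -scalerBl riesz_scale_ge0 ?subr_ge0.
Qed.

Lemma riesz_sum_ge0 (I : Type) (r : seq I) (P : pred I) (f : I -> E) :
  (forall i, 0 <= f i) -> 0 <= \sum_(i <- r | P i) f i.
Proof.
move=> f0; apply: (big_ind (fun x : E => (0 <= x) : Prop)) => // x y x0 y0.
by rewrite -[0]addr0 riesz_leD.
Qed.

Lemma riesz_ler_sum_nat (f : nat -> E) k n : (forall i, 0 <= f i) ->
  (k < n)%N -> f k <= \sum_(0 <= i < n) f i.
Proof.
move=> f0 kn; rewrite big_mkord (bigD1 (Ordinal kn)) //= -[leLHS]addr0.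
by apply: riesz_leD => //; apply: riesz_sum_ge0.
Qed.

Lemma pos_part_ge0 x : 0 <= pos_part x.
Proof. exact: leUr. Qed.

Lemma pos_part_ge x : x <= pos_part x.
Proof. exact: leUl. Qed.

Lemma pos_part_le x y : (pos_part x <= y) = (x <= y) && (0 <= y).
Proof. exact: leUx. Qed.

Lemma le_pos_part x y : x <= y -> pos_part x <= pos_part y.
Proof.
move=> xy; rewrite pos_part_le pos_part_ge0 andbT.
exact: le_trans xy (pos_part_ge y).
Qed.

Lemma pos_part_subr_ge0 x y : 0 <= y -> 0 <= pos_part x - pos_part (x - y).
Proof.
move=> y0; rewrite riesz_subr_ge0 le_pos_part// riesz_leBlDr.
by rewrite -[leLHS]addr0 riesz_leD.
Qed.

Lemma pos_part_subr_le x y : 0 <= y -> pos_part x - pos_part (x - y) <= y.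
Proof.
move=> y0; rewrite riesz_leBlDr pos_part_le addrC.
by rewrite -riesz_leBlDr pos_part_ge -[0]addr0 riesz_leD// pos_part_ge0.
Qed.

(** Since [d] is below [pos_part x] and below [pos_part (- x)], which is at most [pos_part x - x],
    the element [pos_part x - d] still dominates both 0 and [x], hence [pos_part x]; this forces
    [d <= 0]. *)
Lemma pos_part_meetN x : (pos_part x `&` pos_part (- x))%O = 0.
Proof.
apply/eqP; rewrite eq_le lexI !pos_part_ge0 !andbT.
set d := (_ `&` _)%O.
suff : pos_part x <= pos_part x - d.
  by rewrite riesz_leBrDr addrC -[leRHS]add0r riesz_leD2r.
have [dp dq] : d <= pos_part x /\ d <= pos_part (- x).
  by split; [exact: leIl | exact: leIr].
rewrite pos_part_le riesz_subr_ge0 dp andbT riesz_leBrDr addrC -riesz_leBrDr.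
apply: le_trans dq _.
rewrite pos_part_le riesz_subr_ge0 pos_part_ge -{1}[- x]add0r.
by rewrite riesz_leD2r pos_part_ge0.
Qed.

(** With z = a - c b, the second entry is the positive part of c^-1 (-z), which is at most (-z)^+
    because c >= 1; so the meet is squeezed by that of z^+ and (-z)^+. *)
Lemma pos_part_scaled_meet (a b : E) c : 1 <= c ->
  (pos_part (a - c *: b) `&` pos_part (b - c^-1 *: a))%O = 0.
Proof.
move=> c1; have c0 : 0 < c by exact: lt_le_trans c1.
apply/eqP; rewrite eq_le lexI !pos_part_ge0 !andbT.
rewrite -(pos_part_meetN (a - c *: b)) leI2 // opprB pos_part_le pos_part_ge0.
have -> : b - c^-1 *: a = c^-1 *: (c *: b - a).
  by rewrite scalerBr scalerA mulVf ?scale1r ?gt_eqF.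
rewrite andbT; apply: (@le_trans _ _ (c^-1 *: pos_part (c *: b - a))).
  by rewrite riesz_ler_wpZ2l ?pos_part_ge// invr_ge0 ltW.
rewrite -[leRHS]scale1r riesz_ler_wpZ2r ?pos_part_ge0//.
by rewrite invf_le1.
Qed.

Lemma modulus_ge x : x <= modulus x.
Proof. exact: leUl. Qed.

Lemma modulus_ge0 x : 0 <= modulus x.
Proof.
(* Add x <= |x| and -x <= |x|, then halve. *)
have : 0 <= modulus x + modulus x.
  by rewrite -(subrr x) riesz_leD ?modulus_ge// leUr.
move=> /(riesz_ler_wpZ2l (2^-1)); rewrite invr_ge0 ler0n => /(_ isT).
by rewrite scaler0 -mulr2n -(scaler_nat 2 (modulus x)) scalerA mulVf ?scale1r// pnatr_eq0.
Qed.

Lemma ge0_modulus x : 0 <= x -> modulus x = x.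
Proof.
move=> x0; apply/eqP; rewrite eq_le modulus_ge andbT leUx lexx /=.
by rewrite (le_trans _ x0)// -oppr0 riesz_leN2.
Qed.

Lemma disjoint_seq_pos_part (x : nat -> E) y :
  (forall n, 0 <= x n) -> (forall n, 2^-1 ^+ n *: x n <= y) ->
  disjoint_seq (fun n => pos_part
    (x n - 4 ^+ n *: \sum_(0 <= i < n) x i - 2^-1 ^+ n *: y)).
Proof.
move=> x0 xy; set v := fun n => _.
have s0 n : 0 <= \sum_(0 <= i < n) x i by exact: riesz_sum_ge0.
have y0 : 0 <= y by apply: le_trans (xy 0%N); rewrite scale1r.
have p0 n : 0 <= (2^-1 : R) ^+ n by rewrite exprn_ge0// invr_ge0.
have q0 n : 0 <= (4 : R) ^+ n by rewrite exprn_ge0.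
suff lt_disj m n : (n < m)%N -> (v m `&` v n)%O = 0.
  move=> m n; rewrite !ge0_modulus ?pos_part_ge0// neq_lt => /orP[mn|nm].
    by rewrite meetC; exact: lt_disj.
  exact: lt_disj.
move=> nm; apply/eqP; rewrite eq_le lexI !pos_part_ge0 !andbT.
have c1 : 1 <= (2 : R) ^+ (m + n) by rewrite exprn_ege1// ler1n.
rewrite -(pos_part_scaled_meet (x m) (x n) _ c1) leI2//; apply: le_pos_part.
  rewrite -[leRHS]subr0; apply: riesz_leB; last exact: riesz_scale_ge0.
  apply: riesz_leB => //.
  (* As n < m, 2^(m + n) <= 2^(2m) = 4^m, and x_n is one of the summands of S_m. *)
  apply: (@le_trans _ _ (4 ^+ m *: x n)).
    apply: riesz_ler_wpZ2r => //.
    have -> : (4 : R) = 2 ^+ 2 by rewrite -natrX.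
    by rewrite -exprM ler_weXn2l ?ler1n// mul2n -addnn leq_add2l ltnW.
  by apply: riesz_ler_wpZ2l => //; exact: riesz_ler_sum_nat.
(* For v_n the term in S_n is dropped and the one in y is kept: 2^-(m + n) x_m = 2^-n (2^-m x_m) <=
   2^-n y. *)
apply: riesz_leB.
  by rewrite riesz_leBlDr -[leLHS]addr0 riesz_leD// riesz_scale_ge0.
rewrite -exprVn addnC exprD -scalerA.
exact: riesz_ler_wpZ2l.
Qed.

End RieszSpace.

(** * Interaction of norm convergence and order *)

Section BanachLattice.
Context {R : realType} {E : banachLatticeType R}.
Implicit Types x y : E.

Lemma riesz_le_norm x y : 0 <= x -> x <= y -> `|x| <= `|y|.
Proof.
move=> x0 xy; apply: lattice_norm.
by rewrite !ge0_modulus// (le_trans x0).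
Qed.

Lemma norm_modulus x : `|modulus x| = `|x|.
Proof.
have e : modulus (modulus x) = modulus x := ge0_modulus _ (modulus_ge0 x).
by apply/eqP; rewrite eq_le !lattice_norm// e.
Qed.

(** Once x <= f n, one has 0 <= (x - y)^+ <= |f n - y|, so the norm of (x - y)^+ is arbitrarily
    small. *)
Lemma cvg_riesz_ge (f : nat -> E) x y :
  f n @[n --> \oo] --> y -> (\forall n \near \oo, x <= f n) -> x <= y.
Proof.
move=> fy xf.
suff /eqP : `|pos_part (x - y)| == 0.
  move=> /eqP; rewrite normr_eq0 => /eqP e.
  by rewrite -[y]add0r -riesz_leBlDr -e pos_part_ge.
rewrite eq_le normr_ge0 andbT; apply/ler_addgt0Pr => e e0; rewrite add0r.
have : \forall n \near \oo, `|pos_part (x - y)| <= e.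
  near=> n.
  apply: (@le_trans _ _ `|f n - y|); last first.
    by rewrite distrC ltW//; near: n; exact: cvgr_dist_lt.
  rewrite -[leRHS]norm_modulus; apply: riesz_le_norm; first exact: pos_part_ge0.
  rewrite pos_part_le modulus_ge0 andbT (le_trans _ (modulus_ge _))//.
  by rewrite riesz_leD2r; near: n.
by case=> N _ /(_ N); apply; exact: leqnn.
Unshelve. all: by end_near. Qed.

Lemma weighted_seq_ubound (x : nat -> E) :
  (forall n, 0 <= x n) -> (forall n, unit_ball (x n)) ->
  exists y : E, forall n, 2^-1 ^+ n *: x n <= y.
Proof.
move=> x0 xb; pose u n := (2^-1 : R) ^+ n *: x n.
have u0 n : 0 <= u n.
  by rewrite riesz_scale_ge0// exprn_ge0// invr_ge0.
(* Comparison with the geometric series of ratio 1/2 gives absolute convergence, and completeness of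
   [E] gives the sum. *)
have /normed_cvg cu : cvgn [normed series u].
  apply: (@series_le_cvg _ _ (geometric 1 (2^-1))).
  - by move=> n; exact: normr_ge0.
  - by move=> n /=; rewrite mul1r exprn_ge0// invr_ge0.
  - move=> n /=; rewrite mul1r normrZ ger0_norm ?exprn_ge0 ?invr_ge0//.
    by rewrite ler_piMr ?exprn_ge0 ?invr_ge0//; exact: xb.
  - apply: is_cvg_geometric_series.
    by rewrite ger0_norm ?invr_ge0// invf_lt1// ltr1n.
exists (limn (series u)) => k; apply: cvg_riesz_ge cu _.
(* The k-th term occurs in the partial sums from index k + 1 on. *)
exists k.+1 => // n /= kn.
exact: riesz_ler_sum_nat.
Qed.

End BanachLattice.

(** * Uniform operator bounds and the contradiction argument *)

Lemma opnorm_le {R : realType} {E F : normedModType R} (T : {linear E -> F})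
    (x : E) : bounded_fun_norm T -> `|T x| <= opnorm T * `|x|.
Proof.
move=> bT; have [->|x0] := eqVneq x 0; first by rewrite linear0 !normr0 mulr0.
have nx0 : 0 < `|x| by rewrite normr_gt0.
rewrite -ler_pdivrMr// mulrC -[X in X * _]gtr0_norm ?invr_gt0//.
rewrite -normrZ -linearZ; apply: ub_le_sup.
  (* Boundedness on the ball of radius 1 makes the supremum in [opnorm] a genuine one. *)
  by have [M TM] := bT 1; exists M => _ [z zb <-]; exact: TM.
exists (`|x|^-1 *: x) => //; rewrite /unit_ball /= normrZ.
by rewrite gtr0_norm ?invr_gt0// mulVf// gt_eqF.
Qed.

Lemma norm_bounded_le {R : realType} {E F : normedModType R}
    (TT : set {linear E -> F}) : norm_bounded TT ->
  exists2 M : R, 0 <= M & forall T, TT T -> forall x, `|T x| <= M * `|x|.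
Proof.
move=> [bTT [M MTT]]; exists `|M| => // T TTT x.
(* The absolute value is taken because [M] may be negative when [TT] is empty. *)
rewrite (le_trans (opnorm_le T x (bTT T TTT)))// ler_wpM2r//.
by rewrite (le_trans _ (ler_norm M))//; apply: MTT; exists T.
Qed.

Theorem theorem4p5 (R : realType) (E F : banachLatticeType R)
    (TT : set {linear E -> F}) :
  norm_bounded TT -> collectively_Mweakly_compact TT ->
  forall eps : R, 0 < eps ->
  exists2 u : E, pos_cone u &
    forall x : E, unit_ball x ->
      sup [set `|T (pos_part (modulus x - u))| | T in TT] <= eps.
Proof.
move=> /norm_bounded_le[M M0 TM] [_ mwc] eps eps0.
apply/not_exists2P => bad.
have /choice[f fP] (u : E) : exists xT : E * {linear E -> F}, 0 <= u ->
    [/\ unit_ball xT.1, TT xT.2 &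
        eps < `|xT.2 (pos_part (modulus xT.1 - u))|].
  have [u0|nu] := pselect (0 <= u); last by exists (0, \0 : {linear E -> F}).
  have [//|/existsNP[x /not_implyP[xb /negP]]] := bad u.
  rewrite -ltNge => sx.
  have [|_ [T TTT <-] Tx] := sup_gt _ sx; last by exists (x, T).
  (* If [TT] were empty the supremum would be 0 by convention, contradicting 0 < eps < sup. *)
  apply/set0P/eqP => e; move: sx.
  by rewrite e sup0 ltNge (ltW eps0).
(* The choice at stage n depends on the earlier ones only through S_n, so the recursion runs on the
   partial sums; [X] and [A] are read off afterwards. *)
pose S := fix S n : E := if n is k.+1
  then S k + modulus (f (4 ^+ k *: S k)).1 else 0.
pose X n := modulus (f (4 ^+ n *: S n)).1.
pose A n := (f (4 ^+ n *: S n)).2.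
have SE n : S n = \sum_(0 <= i < n) X i.
  by elim: n => [|n IHn]; rewrite ?big_nil ?big_nat_recr//= -IHn.
have X0 n : 0 <= X n by exact: modulus_ge0.
have S0 n : 0 <= 4 ^+ n *: S n.
  by rewrite riesz_scale_ge0 ?exprn_ge0// SE riesz_sum_ge0.
have Xb n : unit_ball (X n).
  by rewrite /unit_ball /= norm_modulus; case: (fP _ (S0 n)).
have [y yX] := weighted_seq_ubound X X0 Xb.
have y0 : 0 <= y by apply: le_trans (yX 0%N); rewrite scale1r.
pose w n := pos_part (X n - 4 ^+ n *: S n).
pose v n := pos_part (X n - 4 ^+ n *: S n - 2^-1 ^+ n *: y).
have t0 n : 0 <= (2^-1 : R) ^+ n by rewrite exprn_ge0// invr_ge0.
have vb n : unit_ball (v n).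
  rewrite /unit_ball /=; apply: le_trans (Xb n).
  apply: riesz_le_norm; first exact: pos_part_ge0.
  rewrite pos_part_le X0 andbT -addrA -opprD riesz_leBlDr -[leLHS]addr0.
  by rewrite riesz_leD// -[0]addr0 riesz_leD// riesz_scale_ge0.
have vd : disjoint_seq v.
  have := disjoint_seq_pos_part X y X0 yX.
  by congr disjoint_seq; apply/funext => n; rewrite /v SE.
have /cvgr0_norm_lt/(_ _ (divr_gt0 eps0 (ltr0n _ 2))) sv := mwc v vb vd.
(* This sequence bounds the norm of T(w_n - v_n) uniformly over T in [TT]. *)
have gy : geometric (M * `|y|) (2^-1) n @[n --> \oo] --> (0 : R).
  apply: cvg_geometric.
  by rewrite ger0_norm ?invr_ge0// invf_lt1// ltr1n.
have /cvgr0_norm_lt/(_ _ (divr_gt0 eps0 (ltr0n _ 2))) sy := gy.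
have [n [Hn1 Hn2]] : exists n,
    `|sup [set `|T (v n)| | T in TT]| < eps / 2 /\
    `|geometric (M * `|y|) (2^-1) n| < eps / 2.
  have [N _ /(_ N (leqnn N)) NP] := filterI sv sy.
  by exists N.
have [_ TA] := fP _ (S0 n).
apply/negP; rewrite -leNgt -/(A n) -/(X n) -/(w n).
have -> : w n = v n + (w n - v n) by rewrite addrC subrK.
(* Each of T_n v_n and T_n (w_n - v_n) accounts for at most eps / 2. *)
rewrite linearD (le_trans (ler_normD _ _))// [eps]splitr lerD//.
  apply: le_trans (ltW Hn1); apply: le_trans (ler_norm _).
  apply: ub_le_sup; last by exists (A n).
  (* The uniform bound [M] lets the single value at [A n] be compared with the supremum. *)
  exists M => _ [T TTT <-]; apply: le_trans (TM T TTT _) _.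
  by rewrite ler_piMr//; exact: vb.
apply: le_trans (ltW Hn2); apply: le_trans (ler_norm _) => /=.
apply: le_trans (TM _ TA _) _; rewrite -mulrA ler_wpM2l// mulrC.
rewrite -[X in X * _](ger0_norm (t0 n)) -normrZ.
by apply: riesz_le_norm; [apply: pos_part_subr_ge0 | apply: pos_part_subr_le];
  rewrite riesz_scale_ge0.
Qed.
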